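(* Let $T>0$, let $f\colon[0,+\infty)\to\mathbb{R}$ be a bounded continuous $T$-periodic function, let $\alpha\in(0,1)$, and suppose that the fractional integral $I^\alpha f$ is a bounded function. Then $I^\alpha f$ is an S-asymptotically $T$-periodic function.
   Context: Write $\mathbb{R}^+=[0,+\infty)$. For $\alpha>0$, the fractional integral of order $\alpha$ of $f$ is $I^\alpha f(t)=\dfrac{1}{\Gamma(\alpha)}\displaystyle\int_0^t (t-s)^{\alpha-1}f(s)\,ds$ for $t>0$, with $I^\alpha f(0)=0$. A bounded continuous function $\varphi\colon\mathbb{R}^+\to\mathbb{R}$ is S-asymptotically $T$-periodic if $\lim_{t\to+\infty}[\varphi(t+T)-\varphi(t)]=0$. *)

(* Defs.v *)
From HB Require Import structures.
From mathcomp Require Import all_boot all_order all_algebra.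
From mathcomp Require Import all_classical all_reals all_analysis.
Set Implicit Arguments.
Unset Strict Implicit.
Unset Printing Implicit Defensive.
Import Order.TTheory GRing.Theory Num.Theory.
Import numFieldNormedType.Exports.
Local Open Scope classical_set_scope.
Local Open Scope ring_scope.

(* A function on the half-line [0, +oo) is represented by a function R -> R of
   which only the restriction to [0, +oo) is ever constrained or used. *)
Definition half_line {R : realType} : set R := `[0, +oo[.

Definition Gamma_fun {R : realType} (a : R) : R :=
  \int[lebesgue_measure]_(x in `]0, +oo[) (x `^ (a - 1) * expR (- x)).

(* The endpoints, where the kernel may be singular, are left out of the domain
   of integration. The value for t < 0 is a convention. *)
Definition frac_integral {R : realType} (a : R) (f : R -> R) (t : R) : R :=
  if 0 < t then
    (Gamma_fun a)^-1 *
      \int[lebesgue_measure]_(s in `]0, t[) ((t - s) `^ (a - 1) * f s)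
  else 0.

Definition periodic_half_line {R : realType} (T : R) (f : R -> R) : Prop :=
  forall t, 0 <= t -> f (t + T) = f t.

Definition bounded_half_line {R : realType} (f : R -> R) : Prop :=
  [bounded f t | t in half_line].

(* The subspace topology gives one-sided continuity at 0. *)
Definition continuous_half_line {R : realType} (f : R -> R) : Prop :=
  {within half_line, continuous f}.

Definition S_asymptotically_periodic {R : realType} (T : R) (phi : R -> R)
    : Prop :=
  [/\ bounded_half_line phi,
      continuous_half_line phi
    & phi (t + T) - phi t @[t --> +oo] --> 0].

(* Main.v *)
Require Import Defs.
From mathcomp Require Import all_boot all_order all_algebra.
From mathcomp Require Import all_classical all_reals all_analysis.
From mathcomp Require Import measurable_realfun.
Import Order.TTheory GRing.Theory Num.Theory.
Import numFieldNormedType.Exports.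
Local Open Scope classical_set_scope.
Local Open Scope ring_scope.

(** Write [a] for the order [alpha], and extend [f] to the whole line by the
    constant [f 0] on the left of [0]; the extension [F] is continuous and
    bounded. Reflecting the variable of integration ([u = t - s]) moves the time
    [t] out of the singular kernel:

      Gamma(a) * I^a f (t) = g(t),
      where g(t) is the integral of u^(a-1) * F(t - u) over 0 <= u <= t.

    In this form both claims about [g] become short.

    - Continuity ([continuous_powR_conv]). The domain of integration still
      moves with [t], but [F (t - u)] is the constant [F 0] for [u >= t], so for
      [t <= N] the integral over [0, t] is the integral over [0, N] minus [F 0]
      times the integral of [u^(a-1)] over ]t, N]. The first is continuous in
      [t] by dominated convergence, the second because it is a primitive of an
      integrable function ([integrable_powR]).

    - Asymptotic periodicity ([powR_conv_shift]). For [u <= t] periodicity gives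
      [F (t + T - u) = F (t - u)], so [g (t + T)] and [g t] differ only by the
      integral over ]t, t + T], where the kernel is at most [t^(a-1)]. Hence
      |g(t + T) - g(t)| <= M * T * t^(a-1), where [M] bounds [F], and this tends
      to [0] because [a < 1]. *)

(** * Real powers near zero and at infinity *)

Lemma continuous_powR {R : realType} (p x : R) :
  0 < x -> {for x, continuous (fun u : R => u `^ p)}.
Proof.
move=> x0; apply/differentiable_continuous/derivable1_diffP.
by apply: derivable_powR; rewrite in_itv/= x0.
Qed.

Lemma integral_powR {R : realType} (a x N : R) : 0 < a -> 0 < x -> x < N ->
  (\int[lebesgue_measure]_(u in `[x, N]) (u `^ (a - 1))%:E
     = (a^-1 * N `^ a)%:E - (a^-1 * x `^ a)%:E)%E.
Proof.
move=> a0 x0 xN.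
have cp p : {in `[x, N], continuous (fun u : R => u `^ p)}.
  move=> y; rewrite in_itv/= => /andP[xy _].
  by apply: continuous_powR; exact: lt_le_trans xy.
have dp y : x < y -> derivable (fun u : R => u `^ a) y 1.
  by move=> xy; apply: derivable_powR; rewrite in_itv/= (lt_trans x0 xy).
rewrite (@continuous_FTC2 _ _ (fun u => a^-1 * u `^ a))//.
- apply: continuous_in_subspaceT => y /set_mem; exact: cp.
- split.
  + move=> y; rewrite in_itv/= => /andP[xy _].
    by apply: derivableM => //; exact: dp.
  + apply: cvgM; first exact: cvg_cst.
    by apply: cvg_at_right_filter; apply: cp; rewrite in_itv/= lexx ltW.
  + apply: cvgM; first exact: cvg_cst.
    by apply: cvg_at_left_filter; apply: cp; rewrite in_itv/= lexx ltW.
- move=> y; rewrite in_itv/= => /andP[xy _].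
  rewrite derive1E deriveM//; last exact: dp.
  rewrite derive_cst scaler0 addr0 -derive1E powR_derive1.
    by rewrite /GRing.scale/= mulKf// gt_eqF.
  by rewrite in_itv/= (lt_trans x0 xy).
Qed.

(** The kernel of the fractional integral has an integrable singularity at [0]:
    by monotone convergence from the intervals [1/(n+1), N], on which the
    integral stays below [N^a / a]. *)
Lemma integrable_powR {R : realType} {a : R} (N : R) : 0 < a ->
  lebesgue_measure.-integrable `[0, N] (EFin \o (fun u : R => u `^ (a - 1))).
Proof.
move=> a0; wlog N0 : N / 0 < N.
  move=> H; have [/H//|N0] := ltP 0 N.
  apply: (@integrableS _ _ _ lebesgue_measure `[0, 1]) (H 1 ltr01) => //.
  by apply: subset_itvl; rewrite bnd_simp (le_trans N0).
have mE (D : set R) : measurable_fun D (EFin \o (fun u : R => u `^ (a - 1))).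
  apply/measurable_EFinP; apply: measurable_funTS; exact: measurable_powR.
apply/integrableP; split; first exact: mE.
under eq_integral do rewrite /= ger0_norm ?powR_ge0//.
rewrite -integral_itv_obnd_cbnd; last exact: mE.
pose F (n : nat) : set R := `[n.+1%:R^-1, N]%classic.
have -> : `]0, N]%classic = \bigcup_n F n.
  apply/seteqP; split => [x/=|x [n _]]; rewrite /F/= !in_itv/=.
    move=> /andP[x0 xN]; near \oo => n; exists n => //=.
    rewrite in_itv/= xN andbT -[x]invrK lef_pV2 ?posrE ?invr_gt0//.
    rewrite (@le_trans _ _ n%:R)// ?ler_nat//.
    by near: n; exact: nbhs_infty_ger.
  by move=> /andP[nx ->]; rewrite (lt_le_trans _ nx)// invr_gt0.
have F_cvg :
    (\int[lebesgue_measure]_(u in F n) (u `^ (a - 1))%:E)%E @[n --> \oo] -->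
    (\int[lebesgue_measure]_(u in \bigcup_n F n) (u `^ (a - 1))%:E)%E.
  apply: ge0_nondecreasing_set_cvg_integral.
  - move=> m n mn; rewrite subsetEset; apply: subset_itvr; rewrite bnd_simp.
    by rewrite lef_pV2 ?posrE// ler_nat.
  - by move=> n; exact: measurable_itv.
  - by move=> n; exact: mE.
  - by move=> n x _; rewrite lee_fin powR_ge0.
apply: (@le_lt_trans _ _ (a^-1 * N `^ a)%:E); last exact: ltry.
rewrite -(cvg_lim _ F_cvg)//; apply: lime_le; first exact: cvgP F_cvg.
near=> n.
rewrite integral_powR ?invr_gt0//; last first.
  rewrite invf_plt ?posrE//.
  apply: (@lt_le_trans _ _ n.+1%:R) => //.
  rewrite (@le_lt_trans _ _ n%:R) ?ltr_nat//.
  by near: n; exact: nbhs_infty_ger.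
by rewrite -EFinB lee_fin gerBl mulr_ge0 ?invr_ge0 ?powR_ge0// ltW.
Unshelve. all: by end_near. Qed.

Lemma le_powR_nonpos {R : realType} (p t u : R) : p <= 0 -> 0 < t -> t <= u ->
  u `^ p <= t `^ p.
Proof.
move=> p0 t0 tu; rewrite -[p]opprK !(powRN _ (- p)).
have u0 := lt_le_trans t0 tu.
rewrite lef_pV2 ?posrE ?powR_gt0//.
by apply: ge0_ler_powR; rewrite ?oppr_ge0// nnegrE ltW.
Qed.

Lemma cvgy_powR_neg {R : realType} (p : R) : p < 0 -> t `^ p @[t --> +oo] --> 0.
Proof.
move=> p0; apply/cvgr0Pnorm_lt => e e0.
have Np0 : 0 < - p by rewrite oppr_gt0.
have /cvgr0Pnorm_lt/(_ _ e0) [d /= d0 dP] := @powR_cvg0 R _ Np0.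
near=> t.
have t0 : 0 < t by near: t; exact: nbhs_pinfty_gt.
rewrite -[p]opprK -mulN1r powRrM powR_inv1 ?ltW//.
apply: dP; rewrite /ball_/= ?invr_gt0// sub0r normrN gtr0_norm ?invr_gt0//.
rewrite invf_plt ?posrE//.
by near: t; apply: nbhs_pinfty_gt; exact: num_real.
Unshelve. all: by end_near. Qed.

(** * Reflection of the Lebesgue measure *)

Lemma lebesgue_measure_reflect {R : realType} (c : R) (A : set R) :
  measurable A ->
  pushforward lebesgue_measure (fun x : R => c - x : measurableTypeR R) A
    = lebesgue_measure A.
Proof.
move=> mA; apply/esym/lebesgue_measure_unique => //=.
  exact: measurable_funB.
move=> mc _ [[x y]] _ <-.
rewrite /pushforward (_ : _ @^-1` _ = `[c - y, c - x[%classic); last first.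
  apply/seteqP; split=> z/=; rewrite !in_itv/=.
    by move=> /andP[xz zy]; rewrite lerBlDr -lerBlDl zy ltrBrDr -ltrBrDl.
  by move=> /andP[xz zy]; rewrite lerBlDr -lerBlDl xz ltrBrDr -ltrBrDl zy.
rewrite !lebesgue_measure_itv/= !lte_fin ltrD2l ltrN2.
by rewrite -!EFinB [in RHS]opprD addrACA subrr add0r opprK (addrC y).
Qed.

(** Deduced from the invariance of the measure rather than from differential
    calculus, so that [h] may be singular at the endpoints. *)
Lemma Rintegral_reflect {R : realType} (t : R) (h : R -> R) :
  measurable_fun [set: R] h ->
  lebesgue_measure.-integrable `]0, t[ (EFin \o (fun s => h (t - s))) ->
  \int[lebesgue_measure]_(s in `]0, t[) h (t - s) =
  \int[lebesgue_measure]_(u in `]0, t[) h u.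
Proof.
move=> mh ih; rewrite /Rintegral; congr fine.
pose phi (s : R) : measurableTypeR R := t - s.
have reflK : phi @^-1` `]0, t[ = `]0, t[%classic.
  by apply/seteqP; split=> s/=; rewrite !in_itv/= subr_gt0 gtrBl andbC.
set D : set R := `]0, t[%classic in ih reflK *.
transitivity (\int[pushforward lebesgue_measure phi]_(u in D) (h u)%:E)%E.
  rewrite integral_pushforward ?reflK//.
  - exact: measurable_funB.
  - exact/measurable_EFinP.
  - exact: measurable_itv.
apply: eq_measure_integral => /=; first exact: measurable_funB.
by move=> mphi A mA _; exact: lebesgue_measure_reflect.
Qed.

(** * Convolution with a power kernel *)

(** Up to the factor [Gamma a], the fractional integral of order [a] of [F] at
    [t]. The closed interval makes the value at [t = 0] vanish by itself and
    matches the interval of [parameterized_integral]. *)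
Definition powR_conv {R : realType} (a : R) (F : R -> R) (t : R) : R :=
  \int[lebesgue_measure]_(u in `[0, t]) (u `^ (a - 1) * F (t - u)).

Section powR_conv_continuous.
Context {R : realType} {a : R} {F : R -> R} {M : R}.
Context (a0 : 0 < a) (cF : continuous F) (FM : forall x, `|F x| <= M).
Local Notation mu := lebesgue_measure.

Let mF : measurable_fun [set: R] F.
Proof. exact: continuous_measurable_fun. Qed.

Lemma integrable_powR_conv (t N : R) :
  mu.-integrable `[0, N] (EFin \o (fun u => u `^ (a - 1) * F (t - u))).
Proof.
apply: (@integrableMl _ _ _ mu `[0, N] _ (EFin \o (fun u => u `^ (a - 1)))
  (fun u => F (t - u))).
- exact: measurable_itv.
- exact: integrable_powR.
- apply: measurable_funTS; apply: measurableT_comp => //.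
  exact: measurable_funB.
- exists M; split; first exact: num_real.
  by move=> x Mx y _ /=; rewrite (le_trans (FM _))// ltW.
Qed.

Lemma Rintegral_powR_conv (t : R) : 0 <= t ->
  \int[mu]_(s in `]0, t[) ((t - s) `^ (a - 1) * F s) = powR_conv a F t.
Proof.
move=> t0; rewrite /powR_conv.
have ioo : mu.-integrable `]0, t[ (EFin \o (fun u => u `^ (a - 1) * F (t - u))).
  apply: integrableS (integrable_powR_conv t t) => //.
  exact: subset_itv_oo_cc.
have icc : mu.-integrable `[0, t[ (EFin \o (fun u => u `^ (a - 1) * F (t - u))).
  apply: integrableS (integrable_powR_conv t t) => //.
  exact: subset_itv_co_cc.
rewrite -Rintegral_itv_bndo_bndc// -Rintegral_itv_obnd_cbnd//.
rewrite -(@Rintegral_reflect _ t (fun s => (t - s) `^ (a - 1) * F s)).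
- by apply: eq_Rintegral => u _; rewrite subKr.
- apply: measurable_funM => //.
  apply: (@measurableT_comp _ _ _ _ _ _ (fun x : R => x `^ (a - 1))).
    exact: measurable_powR.
  exact: measurable_funB.
- by apply: eq_integrable ioo => // u _ /=; rewrite subKr.
Qed.

Lemma powR_conv0 : powR_conv a F 0 = 0.
Proof. by rewrite /powR_conv set_itv1 Rintegral_set1. Qed.

Lemma Rintegral_powR_convB (x t N : R) : 0 <= t <= N ->
  \int[mu]_(u in `[0, N]) (u `^ (a - 1) * F (x - u)) -
  \int[mu]_(u in `[0, t]) (u `^ (a - 1) * F (x - u)) =
  \int[mu]_(u in `]t, N]) (u `^ (a - 1) * F (x - u)).
Proof.
move=> /andP[t0 tN].
apply: Rintegral_itvB; rewrite ?bnd_simp//; exact: integrable_powR_conv.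
Qed.

Local Notation K x :=
  (parameterized_integral mu 0 x (fun u : R => u `^ (a - 1))).

Context (F0 : forall x, x <= 0 -> F x = F 0).

(** Separates the two ways in which [powR_conv] depends on [t]: on the right,
    [t] occurs either in the integrand or in the domain of integration, never in
    both. On ]t, N] the factor [F (t - u)] is the constant [F 0]. *)
Lemma powR_conv_split (t N : R) : 0 <= t <= N ->
  powR_conv a F t =
  \int[mu]_(u in `[0, N]) (u `^ (a - 1) * F (t - u)) - (K N - K t) * F 0.
Proof.
move=> /andP[t0 tN]; have ik := integrable_powR N a0.
rewrite /parameterized_integral Rintegral_itvB ?bnd_simp//.
rewrite -RintegralZr//; last first.
  by apply: integrableS ik => //; apply: subset_itvr; rewrite bnd_simp.
have -> : \int[mu]_(u in `]t, N]) (u `^ (a - 1) * F 0) =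
    \int[mu]_(u in `]t, N]) (u `^ (a - 1) * F (t - u)).
  apply: eq_Rintegral => u; rewrite inE/= in_itv/= => /andP[tu _].
  by rewrite (F0 (t - u))// subr_le0 ltW.
rewrite -Rintegral_powR_convB ?t0//.
by rewrite opprB addrC subrK.
Qed.

Lemma continuous_powR_conv_itv (N : R) : 0 < N ->
  {within `[0, N], continuous (powR_conv a F)}.
Proof.
move=> N0.
apply: (@subspace_eq_continuous _ _ _ (fun t =>
  \int[mu]_(u in `[0, N]) (u `^ (a - 1) * F (t - u)) - (K N - K t) * F 0)).
  by move=> t; rewrite inE/= in_itv/= => tN; apply/esym/powR_conv_split.
have cK := parameterized_integral_continuous (ltW N0) (integrable_powR N a0).
have cJ : {within `[0, N], continuous (fun t =>
    \int[mu]_(u in `[0, N]) (u `^ (a - 1) * F (t - u)))}.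
  apply: continuous_in_subspaceT => t; rewrite inE/= in_itv/= => /andP[t0 tN].
  (* The parameter has to range over an open interval, here ]-1, N + 1[, which
     contains [0, N]. *)
  apply: (@continuity_under_integral _ _ _ mu
    (fun t u => u `^ (a - 1) * F (t - u)) `[0, N]%classic _ (-1) (N + 1) _ _
    (fun u => u `^ (a - 1) * M)).
  - exact: measurable_itv.
  - by move=> x _; exact: integrable_powR_conv.
  - apply: aeW => u _ x _; apply: cvgM; first exact: cvg_cst.
    apply: (@cvg_comp _ _ _ (fun x => x - u) F); last exact: cF.
    by apply: cvgB; [exact: cvg_id|exact: cvg_cst].
  - exact: integrableZr (integrable_powR N a0).
  - move=> x _; apply: aeW => u _.
    by rewrite normrM ger0_norm ?powR_ge0// ler_wpM2l ?powR_ge0.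
  - by rewrite inE/= in_itv/= (lt_le_trans _ t0)// (le_lt_trans tN)// ltrDl.
move=> t; apply: cvgB; first exact: cJ.
apply: cvgM; last exact: cvg_cst.
by apply: cvgB; [exact: cvg_cst|exact: cK].
Qed.

Lemma continuous_powR_conv : {within `[0, +oo[, continuous (powR_conv a F)}.
Proof.
apply/continuous_within_itvcyP; split.
  move=> t; rewrite in_itv/= andbT => t0.
  have t10 : 0 < t + 1 by rewrite addr_gt0.
  have /(continuous_within_itvP _ t10)[+ _ _] := continuous_powR_conv_itv _ t10.
  by apply; rewrite in_itv/= t0 ltrDl ltr01.
by have /(continuous_within_itvP _ ltr01)[] := continuous_powR_conv_itv _ ltr01.
Qed.

End powR_conv_continuous.

(** * Increments over one period *)

(** The kernel decreases and, by periodicity, only the stretch ]t, t + T] of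
    length [T] contributes. *)
Lemma powR_conv_shift {R : realType} (a M T : R) (F : R -> R) (t : R) :
  0 < a < 1 -> continuous F -> (forall x, `|F x| <= M) ->
  0 <= T -> (forall x, 0 <= x -> F (x + T) = F x) -> 0 < t ->
  `|powR_conv a F (t + T) - powR_conv a F t| <= M * T * t `^ (a - 1).
Proof.
move=> /andP[a0 a1] cF FM T0 FT t0.
have tT : 0 <= t <= t + T by rewrite ltW//= lerDl.
have -> : powR_conv a F t =
    \int[lebesgue_measure]_(u in `[0, t]) (u `^ (a - 1) * F (t + T - u)).
  apply: eq_Rintegral => u; rewrite inE/= in_itv/= => /andP[_ ut].
  by rewrite addrAC FT// subr_ge0.
rewrite /powR_conv (Rintegral_powR_convB a0 cF FM)//.
set D : set R := `]t, t + T]%classic.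
have mD : measurable (D : set (measurableTypeR R)) by exact: measurable_itv.
have iD : lebesgue_measure.-integrable D
    (EFin \o (fun u => u `^ (a - 1) * F (t + T - u))).
  apply: integrableS (integrable_powR_conv a0 cF FM (t + T) (t + T)) => //.
  by apply: subset_itvr; rewrite bnd_simp ltW.
apply: (le_trans (le_normr_Rintegral mD iD)).
have <- : \int[lebesgue_measure]_(u in D) (M * t `^ (a - 1)) =
    M * T * t `^ (a - 1).
  rewrite Rintegral_cst// /D /= lebesgue_measure_itv/= lte_fin ltrDl.
  case: ltrP => [T0'|T0']; first by rewrite /= (addrC t) addrK mulrAC.
  by rewrite (@le_anti _ _ T 0) ?T0 ?T0'// mulr0 mulr0 mul0r.
apply: le_Rintegral => //.
- exact: integrable_norm.
- apply: (@measurable_bounded_integrable _ _ _ lebesgue_measure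
    (fun=> M * t `^ (a - 1)) D) => //.
  + by rewrite /D /= lebesgue_measure_itv/=; case: ifP => _; exact: ltry.
  + exact: bounded_cst.
- move=> u; rewrite /D/= in_itv/= => /andP[tu _].
  rewrite normrM ger0_norm ?powR_ge0// mulrC ler_pM ?powR_ge0//.
  by apply: le_powR_nonpos => //; [rewrite subr_le0|]; exact: ltW.
Qed.

(** * Fractional integrals of periodic functions *)

Lemma continuous_clamp {R : realType} (f : R -> R) :
  {within `[0, +oo[, continuous f} -> continuous (fun x : R => f (Num.max x 0)).
Proof.
move=> /subspace_continuousP cf x.
have mx0 (y : R) : `[0, +oo[%classic (Num.max y 0).
  by rewrite /= in_itv/= andbT le_max lexx orbT.
have cm : {for x, continuous (fun y : R => Num.max y 0)}.
  by apply: (@continuous_max _ _ id (cst 0)); [exact: cvg_id|exact: cvg_cst].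
apply: cvg_comp (cf _ (mx0 x)) => P WP.
have : nbhs x [set y : R | `[0, +oo[%classic (Num.max y 0) -> P (Num.max y 0)].
  exact: (cm _ WP).
by apply: filterS => y; apply.
Qed.

Theorem theorem2 (R : realType) (T : R) (f : R -> R) (alpha : R)
    (hT : 0 < T)
    (f_bounded : bounded_half_line f)
    (f_continuous : continuous_half_line f)
    (f_periodic : periodic_half_line T f)
    (halpha : 0 < alpha < 1)
    (If_bounded : bounded_half_line (frac_integral alpha f)) :
  S_asymptotically_periodic T (frac_integral alpha f).
Proof.
have /andP[a0 a1] := halpha.
pose F x := f (Num.max x 0).
have Ff x : 0 <= x -> F x = f x by move=> x0; rewrite /F max_l.
have F0 x : x <= 0 -> F x = F 0 by move=> x0; rewrite /F max_r// maxxx.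
have cF : continuous F by exact: continuous_clamp.
have [M FM] : exists M, forall x, `|F x| <= M.
  have [M [_ /(_ (M + 1))HM]] := f_bounded.
  exists (M + 1) => x; apply: HM; first by rewrite ltrDl.
  by rewrite /half_line/= in_itv/= andbT le_max lexx orbT.
have IfE t : 0 <= t ->
    frac_integral alpha f t = (Gamma_fun alpha)^-1 * powR_conv alpha F t.
  rewrite /frac_integral le_eqVlt => /predU1P[<-|t0].
    by rewrite ltxx powR_conv0 mulr0.
  rewrite t0 -(Rintegral_powR_conv a0 cF FM) ?ltW//; congr (_ * _).
  apply: eq_Rintegral => s; rewrite inE/= in_itv/= => /andP[s0 _].
  by rewrite Ff// ltW.
split => //.
- apply: (@subspace_eq_continuous _ _ _
    (fun t => (Gamma_fun alpha)^-1 * powR_conv alpha F t)).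
    by move=> t; rewrite inE /half_line/= in_itv/= andbT => t0; exact/esym/IfE.
  move=> t; apply: cvgM; first exact: cvg_cst.
  exact: (continuous_powR_conv a0 cF FM F0).
- pose C := `|(Gamma_fun alpha)^-1| * (M * T).
  apply/norm_cvg0P.
  apply: (@squeeze_cvgr _ _ _ _ (cst 0) (fun t => C * t `^ (alpha - 1))).
  + near=> t; have t0 : 0 < t by near: t; exact: nbhs_pinfty_gt.
    rewrite normr_ge0/= /C !IfE ?(ltW t0) ?(ltW (addr_gt0 t0 hT))//.
    rewrite -mulrBr normrM -mulrA ler_wpM2l//.
    apply: powR_conv_shift => //; first exact: ltW.
    by move=> x x0; rewrite !Ff ?(addr_ge0 x0 (ltW hT))//; exact: f_periodic.
  + exact: cvg_cst.
  + rewrite -[X in _ --> X](mulr0 C); apply: cvgM; first exact: cvg_cst.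
    by apply: cvgy_powR_neg; rewrite subr_lt0.
Unshelve. all: by end_near. Qed.
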